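(* Let $q$ be a prime power. Every blocking set $\mathcal{B}$ in $\mathrm{PG}(2,q)$ of size $k\le 2q-1$ does not have the $r_\infty$-property with respect to any point $P\in\mathcal{B}$.
   Context: A blocking set of $\mathrm{PG}(2,q)$ is a set of points meeting every line and containing no line. A line is tangent to a point set $\mathcal{K}$ if it meets $\mathcal{K}$ in exactly one point, secant if in more than one. A blocking set $\mathcal{B}$ has the $r_\infty$-property with respect to $P\in\mathcal{B}$ if exactly one line through $P$ is tangent to $\mathcal{B}$ and all other lines through $P$ are secants. *)

(* Defs.v *)
From HB Require Import structures.
From mathcomp Require Import all_boot all_order all_algebra all_field.

Set Implicit Arguments.
Unset Strict Implicit.
Unset Printing Implicit Defensive.

Definition prime_power (q : nat) : Prop :=
  exists p e : nat, [/\ prime p, 0 < e & q = p ^ e].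

Section ProjectivePlane.

Variable F : finFieldType.

(* PG(2,q) is the lattice of subspaces of F^3 for F the field with q elements. *)
Definition pg_point : predArgType := {U : {vspace 'rV[F]_3} | \dim U == 1}.
Definition pg_line : predArgType := {U : {vspace 'rV[F]_3} | \dim U == 2}.

(* {vspace _} carries no finType structure in the library, so finiteness of the
   point set is obtained by encoding a subspace as the finite set of its
   vectors, and decoding such a set by taking its span. *)
Definition vectors_of (P : pg_point) : {set 'rV[F]_3} :=
  [set v | v \in val P].

Definition point_spanned_by (A : {set 'rV[F]_3}) : option pg_point :=
  insub <<enum A>>%VS.

Lemma vectors_ofK : pcancel vectors_of point_spanned_by.
Proof.
move=> P; rewrite /point_spanned_by.
suff -> : <<enum (vectors_of P)>>%VS = val P by rewrite valK.
apply/eqP; rewrite eqEsubv; apply/andP; split.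
  by apply/span_subvP => v; rewrite mem_enum inE.
by apply/subvP => v Pv; rewrite memv_span // mem_enum inE.
Qed.

HB.instance Definition _ := Choice.on pg_point.
HB.instance Definition _ : isCountable pg_point := PCanIsCountable vectors_ofK.
HB.instance Definition _ : isFinite pg_point := PCanIsFinite vectors_ofK.

Definition incident (P : pg_point) (l : pg_line) : bool :=
  (val P <= val l)%VS.

Definition points_of (l : pg_line) : {set pg_point} :=
  [set P | incident P l].

Definition blocking_set (B : {set pg_point}) : Prop :=
  (forall l : pg_line, B :&: points_of l != set0) /\
  ~ (exists l : pg_line, points_of l \subset B).

Definition tangent (K : {set pg_point}) (l : pg_line) : Prop :=
  #|K :&: points_of l| = 1.

Definition secant (K : {set pg_point}) (l : pg_line) : Prop :=
  1 < #|K :&: points_of l|.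

Definition r_infty_property (B : {set pg_point}) (P : pg_point) : Prop :=
  exists t : pg_line,
    unique (fun l => incident P l /\ tangent B l) t /\
    (forall l : pg_line, incident P l -> l <> t -> secant B l).

End ProjectivePlane.

(* Main.v *)
Require Import Defs.
From HB Require Import structures.
From mathcomp Require Import all_boot all_order all_algebra all_field.
From mathcomp Require Import ring.

(** Deleting the tangent t at P turns B \ {P} into a set of at most 2q - 2 points
    of the affine plane PG(2,q) \ t meeting every affine line, against the
    Jamison / Brouwer-Schrijver bound. For the latter, take one of its points as
    the origin; the lines avoiding it are a x + b y = 1 with (a, b) <> (0, 0), so
    the product of the a x + b y - 1 over the other points (x, y) vanishes
    exactly off (a, b) = (0, 0). Its sum over all (a, b) is thus nonzero, which
    is impossible for a polynomial of degree less than 2 (q - 1). *)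

Set Implicit Arguments.
Unset Strict Implicit.
Unset Printing Implicit Defensive.

Import GRing.Theory.

Section Plane.

Variable F : finFieldType.

Local Open Scope ring_scope.

(** For [i > 0], substituting [c * a] for [a] multiplies the sum by [c ^+ i], and some nonzero [c]
    has [c ^+ i != 1] because ['X^i - 1] has at most [i] roots. *)
Lemma sum_expr_finField (i : nat) :
  (i < #|F|.-1)%N -> \sum_(a : F) a ^+ i = 0.
Proof.
(* For exponent 0 every term is 1, also at [a = 0]; invariance of the sum of all [a] under
   translation by 1 shows that these ones add up to 0. *)
case: i => [_|i lt_iq].
  have /eqP : \sum_(a : F) a = \sum_(a : F) (a + 1).
    by rewrite (reindex_inj (addIr 1)).
  by rewrite big_split /= -[X in X == _]addr0 (inj_eq (addrI _)) => /eqP <-.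
have [c c0 ci1] : exists2 c : F, c != 0 & c ^+ i.+1 != 1.
  apply/exists_inP; apply: contraLR lt_iq => /exists_inPn noc.
  rewrite -leqNgt -(cardC1 (0 : F)) cardE.
  have := @max_poly_roots F ('X^(i.+1) - 1) (enum (predC1 0)).
  rewrite size_XnsubC // ltnS; apply; rewrite ?enum_uniq //.
    by rewrite -size_poly_eq0 size_XnsubC.
  apply/allP => c; rewrite mem_enum inE => c0.
  by rewrite /root !hornerE subr_eq0; have := noc c c0; rewrite negbK.
have S_eq : \sum_(a : F) a ^+ i.+1 = c ^+ i.+1 * \sum_(a : F) a ^+ i.+1.
  rewrite {1}(reindex_inj (mulfI c0)) mulr_sumr.
  by apply: eq_bigr => a _; rewrite exprMn.
apply/eqP; have /eqP := S_eq.
rewrite -subr_eq0 -{1}[X in X - _]mul1r -mulrBl mulf_eq0 subr_eq0 eq_sym.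
by rewrite (negPf ci1).
Qed.

(** The monomial is carried for the induction: expanding one factor shortens [s] by one and raises
    [i + j] by at most one. Once [s] is empty the sum splits into two power sums, one of them with
    exponent below [#|F|.-1]. *)
Lemma sum_monomial_prod_affine (I : Type) (s : seq I) (x y z : I -> F) (i j : nat) :
  (i + j + size s < 2 * #|F|.-1)%N ->
  \sum_(a : F) \sum_(b : F)
     a ^+ i * b ^+ j * \prod_(k <- s) (a * x k + b * y k + z k) = 0.
Proof.
elim: s i j => [|k s IHs] i j /= lt_ij.
  under eq_bigr do under eq_bigr do rewrite big_nil mulr1.
  under eq_bigr do rewrite -mulr_sumr.
  rewrite -mulr_suml.
  have [lt_i|le_i] := ltnP i #|F|.-1; first by rewrite sum_expr_finField ?mul0r.
  rewrite [X in _ * X]sum_expr_finField ?mulr0 //.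
  move: lt_ij; rewrite addn0 mul2n -addnn.
  by move=> /leq_trans-/(_ _ (leq_add le_i (leqnn _))); rewrite ltn_add2l.
pose S i j := \sum_(a : F) \sum_(b : F)
  a ^+ i * b ^+ j * \prod_(k <- s) (a * x k + b * y k + z k).
transitivity (x k * S i.+1 j + y k * S i j.+1 + z k * S i j).
  rewrite /S !mulr_sumr -!big_split /=; apply: eq_bigr => a _.
  rewrite !mulr_sumr -!big_split /=; apply: eq_bigr => b _.
  by rewrite big_cons !exprS; ring.
have lt_s : (i + j + size s < 2 * #|F|.-1)%N.
  by apply: ltn_trans lt_ij; rewrite addnS.
by rewrite /S !IHs ?mulr0 ?addr0 // ?addSn ?addnS // -addnS.
Qed.

Lemma prod_affine_not_all_zero (I : Type) (s : seq I) (x y z : I -> F) :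
  (size s < 2 * #|F|.-1)%N -> \prod_(k <- s) z k != 0 ->
  exists a b : F, (a, b) != (0, 0) /\
    \prod_(k <- s) (a * x k + b * y k + z k) != 0.
Proof.
move=> lt_s z0.
pose f (u : F * F) := \prod_(k <- s) (u.1 * x k + u.2 * y k + z k).
have /existsP[[a b] /andP[ab0 fab0]] : [exists u, (u != (0, 0)) && (f u != 0)].
  apply: contraNT z0 => /existsPn f0; apply/eqP.
  have : \sum_(a : F) \sum_(b : F) f (a, b) = 0.
    rewrite -[RHS](@sum_monomial_prod_affine I s x y z 0 0 lt_s).
    by under [RHS]eq_bigr do under eq_bigr do rewrite !expr0 !mul1r.
  rewrite (pair_bigA _ (fun a b => f (a, b))) /= (bigD1 (0, 0)) //= big1.
    rewrite addr0 => <-; rewrite /f /=.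
    by apply: eq_bigr => k _; rewrite !mul0r !add0r.
  by case=> a b ab0; have := f0 (a, b); rewrite ab0 /= negbK => /eqP.
by exists a, b.
Qed.

(** A nonzero functional is onto the one-dimensional [F^o], so its kernel has dimension 3 - 1 =
    2. *)
Lemma kernel_line (f : 'rV[F]_3 -> F^o) (v0 : 'rV[F]_3) :
  linear f -> f v0 != 0 ->
  exists l : pg_line F, forall v, (v \in val l) = (f v == 0).
Proof.
move=> lin_f.
pose fL : {linear 'rV[F]_3 -> F^o} :=
  HB.pack f (GRing.isLinear.Build _ _ _ _ f lin_f).
rewrite -[f]/(fL : _ -> _); move: fL => {lin_f}f fv0.
have dim_ker : \dim (lker (linfun f)) == 2%N.
  have := limg_ker_dim (linfun f) fullv; rewrite capfv dimvf /dim /= mul1n.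
  suff -> : (linfun f @: fullv)%VS = fullv by rewrite dimvf /dim /= addn1 => -[->].
  apply/eqP; rewrite -dimv_leqif_eq ?subvf // dimvf /dim /= eqn_leq.
  rewrite -[X in (_ <= X)%N && _]/(dim F^o) -dimvf dimvS ?subvf // lt0n dimv_eq0.
  apply: contraNneq fv0 => im0; rewrite -memv0 -im0.
  by have := memv_img (linfun f) (memvf v0); rewrite lfunE.
by exists (exist _ (lker (linfun f)) dim_ker) => v; rewrite memv_ker lfunE.
Qed.

(** Two distinct coordinate lines cannot both be [t]. This supplies a first point of the affine
    blocking set, to serve as origin. *)
Lemma exists_other_line (t : pg_line F) : exists l : pg_line F, l <> t.
Proof.
pose f (j : 'I_3) (v : 'rV[F]_3) : F^o := v ord0 j.
have lin_f j : linear (f j) by move=> c u v; rewrite /f !mxE.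
have fE j k : f j (delta_mx 0 k) = (j == k)%:R by rewrite /f mxE.
have line_f j : exists l : pg_line F, forall v, (v \in val l) = (f j v == 0).
  by apply: (kernel_line (v0 := delta_mx 0 j)); rewrite // fE eqxx oner_eq0.
have [l lE] := line_f ord0; have [m mE] := line_f ord_max.
have [lt|] := eqVneq l t; last by exists l; apply/eqP.
exists m => mt; have := mE (delta_mx 0 ord0).
by rewrite mt -lt lE !fE /= oner_eq0 eqxx.
Qed.

Definition point_vector (Q : pg_point F) := vpick (val Q).

Lemma point_vector_neq0 (Q : pg_point F) : point_vector Q != 0.
Proof. by rewrite vpick0 -dimv_eq0 (eqP (valP Q)). Qed.

Lemma incidentE (Q : pg_point F) (l : pg_line F) :
  incident Q l = (point_vector Q \in val l).
Proof.
rewrite /incident memvE; congr (_ <= _)%VS; apply/esym/eqP.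
rewrite -dimv_leqif_eq -?memvE ?memv_pick // dim_vline point_vector_neq0.
by rewrite (eqP (valP Q)).
Qed.

Lemma line_coordinates (t : pg_line F) (w : 'rV[F]_3) :
  w \notin val t ->
  exists X : 3.-tuple 'rV[F]_3,
    [/\ free X, tnth X ord0 = w,
        forall i, i != ord0 -> tnth X i \in val t &
        forall v, coord X ord0 v = 0 -> v \in val t].
Proof.
move=> wt; have dim_t := eqP (valP t).
(* A basis of [t] extended by [w]; the cast fixes its length, so that coordinates are indexed by
   ['I_3]. *)
pose X := [tuple of w :: tcast dim_t (vbasis (val t))].
have XE : X = w :: vbasis (val t) :> seq _ by rewrite /= val_tcast.
have freeX : free X.
  by rewrite XE free_cons (span_basis (vbasisP _)) wt (basis_free (vbasisP _)).
have Xt i : i != ord0 -> tnth X i \in val t.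
  case: (unliftP ord0 i) => [j ->|->] // _.
  rewrite (tnth_nth 0) XE /= vbasis_mem // mem_nth // size_tuple dim_t.
  exact: ltn_ord.
exists X; split=> // v v0.
have /coord_span -> : v \in <<X>>%VS.
  suff -> : <<X>>%VS = fullv by rewrite memvf.
  apply/eqP; rewrite -dimv_leqif_eq ?subvf // (eqP freeX) size_tuple.
  by rewrite dimvf.
rewrite memv_suml // => i _; have [->|i0] := eqVneq i ord0.
  by rewrite v0 scale0r mem0v.
by rewrite memvZ // -tnth_nth Xt.
Qed.

Lemma jamison_bound (t : pg_line F) (A : {set pg_point F}) :
  (forall Q, Q \in A -> ~~ incident Q t) ->
  (forall l, l <> t -> exists2 Q, Q \in A & incident Q l) ->
  (2 * #|F|.-1 < #|A|)%N.
Proof.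
move=> At blockA; have [l0 /blockA[Q0 AQ0 _]] := exists_other_line t.
(* Without the origin [Q0], it is the number of remaining factors that has to reach
   [2 * #|F|.-1]. *)
rewrite (cardsD1 Q0) AQ0 ltnS.
have := At _ AQ0; rewrite incidentE => /line_coordinates[X [freeX X0 Xt Xker]].
rewrite leqNgt; apply/negP => ltA.
(* In these homogeneous coordinates t is the line x_0 = 0 and Q0 is the origin.
   Representatives are not normalised to x_0 = 1, so the factor of Q is
   a x_1 + b x_2 - x_0. *)
pose x i (Q : pg_point F) : F := coord X i (point_vector Q).
have xX i j : coord X i (tnth X j) = (j == i)%:R.
  by rewrite (tnth_nth 0) coord_free.
pose i1 : 'I_3 := inord 1; pose i2 : 'I_3 := inord 2.
have [||a [b [ab0]]] := @prod_affine_not_all_zero _ (enum (A :\ Q0)) (x i1) (x i2)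
  (fun Q => - x ord0 Q).
- by rewrite -cardE.
- rewrite prodf_seq_neq0; apply/allP => Q; rewrite mem_enum => /setD1P[_ AQ].
  rewrite oppr_eq0; apply: contraNneq (At Q AQ); rewrite incidentE; exact: Xker.
apply/negP; rewrite negbK.
pose f v : F^o := a * coord X i1 v + b * coord X i2 v - coord X ord0 v.
have lin_f : linear f.
  by move=> c u v; rewrite /f !linearP /= /GRing.scale /=; ring.
(* The value -1 makes [f] nonzero and keeps its kernel off [Q0]. The values [a] and [b] on the basis
   of [t], not both 0, keep the kernel from being [t]. *)
have fX0 : f (tnth X ord0) = -1.
  by rewrite /f !xX -!val_eqE /= !inordK // !mulr0 !add0r.
have fX1 : f (tnth X i1) = a.
  by rewrite /f !xX -!val_eqE /= !inordK // mulr1 mulr0 subr0 addr0.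
have fX2 : f (tnth X i2) = b.
  by rewrite /f !xX -!val_eqE /= !inordK // mulr1 mulr0 subr0 add0r.
have [|l lE] := kernel_line lin_f (v0 := tnth X ord0).
  by rewrite fX0 oppr_eq0 oner_eq0.
have [|Q AQ Ql] := blockA l.
  move=> lt; move: ab0; rewrite xpair_eqE -{1}fX1 -fX2 -!lE lt !Xt //;
    by rewrite -val_eqE /= inordK.
rewrite incidentE lE in Ql.
have QQ0 : Q != Q0.
  by apply: contraTneq Ql => ->; rewrite -X0 fX0 oppr_eq0 oner_eq0.
by rewrite prodf_seq_eq0; apply/hasP; exists Q; rewrite ?mem_enum ?inE ?QQ0.
Qed.

End Plane.

Theorem theorem4p1 (q : nat) (hq : prime_power q)
    (F : finFieldType) (hF : #|F| = q)
    (B : {set pg_point F}) (hB : blocking_set B)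
    (k : nat) (hk : #|B| = k) (hkq : k <= 2 * q - 1)
    (P : pg_point F) (hP : P \in B) :
  ~ r_infty_property B P.
Proof.
move=> [t [[[Pt tan_t] _] sec]]; have [block _] := hB.
have BtP Q : (Q \in B) && incident Q t = (Q == P).
  have /eqP/cards1P[R BtR] := tan_t.
  have memBt Q' : (Q' \in B) && incident Q' t = (Q' == R).
    by rewrite -in_set1 -BtR !inE.
  by have := memBt P; rewrite hP Pt memBt => /esym/eqP ->.
(* Restoring [P] to the at least 2q - 1 remaining points gives [B] at least 2q points, one more than
   [hkq] allows. *)
suff ltB : 2 * #|F|.-1 < #|B :\ P|.
  move: hkq; rewrite -hk (cardsD1 P) hP -hF leqNgt => /negP; apply.
  by case: #|F| ltB => // n ltB; rewrite add1n ltnS subn1 mulnS.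
apply: (jamison_bound (t := t)) => [Q /setD1P[QP BQ]|l lt].
  by apply: contra QP => Qt; rewrite -BtP BQ.
(* Through [P], the line is a secant and has a second point of [B]; otherwise any point of [B]
   blocking it differs from [P]. *)
have [Pl|nPl] := boolP (incident P l).
  have := sec l Pl lt; rewrite /secant (cardsD1 P) !inE hP Pl ltnS card_gt0.
  case/set0Pn => Q /setD1P[QP]; rewrite !inE => /andP[BQ Ql].
  by exists Q; rewrite // !inE QP.
have /set0Pn[Q] := block l; rewrite !inE => /andP[BQ Ql].
by exists Q; rewrite // !inE BQ andbT; apply: contraNneq nPl => <-.
Qed.
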